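(* Let $\mathbb{X}$ and $\mathbb{Y}$ be Hausdorff topological spaces, let $\Phi:\mathbb{X}\to 2^{\mathbb{Y}}\setminus\{\emptyset\}$ be a set-valued mapping, and let $u:\mathrm{Gr}_{\mathbb{X}}(\Phi)\subseteq\mathbb{X}\times\mathbb{Y}\to\overline{\mathbb{R}}$, $x\in\mathbb{X}$, and $\lambda\in\mathbb{R}$ satisfy $u(x,y)\le\lambda$ for some $y\in\Phi(x)$. If the function $u_{\lambda,x}:\mathrm{Gr}_{\mathbb{X}}(\Phi_{\lambda,x})\subseteq\mathbb{X}\times\mathbb{Y}\to\overline{\mathbb{R}}$ is $\mathbb{K}\mathbb{N}$-inf-compact on $\mathrm{Gr}_{\{x\}}(\Phi_{\lambda,x})$, then the value function $v:\mathbb{X}\to\overline{\mathbb{R}}$ is lower semi-continuous at $x$ and $\Phi^*(x)$ is a nonempty compact subset of $\mathbb{Y}$.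
   Context: $\overline{\mathbb{R}}=\mathbb{R}\cup\{\pm\infty\}$. For $Z\subseteq\mathbb{X}$ and a set-valued mapping $F:\mathbb{X}\to 2^{\mathbb{Y}}$, $\mathrm{Gr}_Z(F)=\{(x,y)\in Z\times\mathbb{Y}: y\in F(x)\}$. The value function is $v(z):=\inf_{y\in\Phi(z)}u(z,y)$, $z\in\mathbb{X}$, and the solution multifunction is $\Phi^*(z):=\{y\in\Phi(z): v(z)=u(z,y)\}$, $z\in\mathbb{X}$. For $\lambda\in\mathbb{R}$ and $x\in\mathbb{X}$, the mapping $\Phi_{\lambda,x}:\mathbb{X}\to 2^{\mathbb{Y}}$ is defined by $\Phi_{\lambda,x}(z):=\{y\in\Phi(z): u(z,y)\le\lambda\}$ if either this set is nonempty or $z=x$, and $\Phi_{\lambda,x}(z):=\Phi_{\lambda,x}(x)$ otherwise. If $\Phi_{\lambda,x}(x)\ne\emptyset$ (so that all values of $\Phi_{\lambda,x}$ are nonempty), the function $u_{\lambda,x}$ is defined, for $(z,y)\in\mathrm{Gr}_{\mathbb{X}}(\Phi_{\lambda,x})$, by $u_{\lambda,x}(z,y):=u(z,y)$ if $\{y'\in\Phi(z): u(z,y')\le\lambda\}\ne\emptyset$, and $u_{\lambda,x}(z,y):=u(x,y)$ otherwise. For a nonempty subset $A$ of a Hausdorff topological space $\mathbb{A}$, a function $f:A\subseteq\mathbb{A}\to\overline{\mathbb{R}}$ is lower semi-continuous at $a\in A$ if $\liminf_i f(a_i)\ge f(a)$ for each net $\{a_i\}_{i\in I}\subset A$ converging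 to $a$ in $\mathbb{A}$. For a set-valued mapping $\Psi:\mathbb{X}\to 2^{\mathbb{Y}}\setminus\{\emptyset\}$ and a nonempty set $Z\subseteq\mathbb{X}$, a function $w:\mathrm{Gr}_{\mathbb{X}}(\Psi)\subseteq\mathbb{X}\times\mathbb{Y}\to\overline{\mathbb{R}}$ is called $\mathbb{K}\mathbb{N}$-inf-compact on $\mathrm{Gr}_Z(\Psi)$ if: (1) $w:\mathrm{Gr}_{\mathbb{X}}(\Psi)\subseteq\mathbb{X}\times\mathbb{Y}\to\overline{\mathbb{R}}$ is lower semi-continuous at all $(x,y)\in\mathrm{Gr}_Z(\Psi)$; (2) if a net $\{x_i\}_{i\in I}$ with values in $\mathbb{X}$ converges to $x\in Z$, then each net $\{y_i\}_{i\in I}$, defined on the same index set $I$, with $y_i\in\Psi(x_i)$ for all $i\in I$ and such that the set $\{w(x_i,y_i): i\in I\}$ is bounded above (by a real number), has an accumulation point $y\in\Psi(x)$. *)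

(* Defs.v *)
From HB Require Import structures.
From mathcomp Require Import all_boot all_order all_algebra.
From mathcomp Require Import all_classical all_reals all_analysis.

Set Implicit Arguments.
Unset Strict Implicit.
Unset Printing Implicit Defensive.

Local Open Scope classical_set_scope.
Local Open Scope ereal_scope.

(* A net in T is a function a : I -> T on a directed set (I, le); I is an
   arbitrary Type and le is not required to be antisymmetric. *)
Record directed (I : Type) (le : I -> I -> Prop) : Prop := Directed {
  directed_inhabited : inhabited I ;
  directed_refl : forall i, le i i ;
  directed_trans : forall i j k, le i j -> le j k -> le i k ;
  directed_ub : forall i j, exists k, le i k /\ le j k }.

(* The filter of eventual sets.  Through it, convergence of a net a to l is
   a @ tails le --> l, and the accumulation points of a (the l such that a is
   frequently in every neighbourhood of l) form cluster (a @ tails le). *)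
Definition tails (I : Type) (le : I -> I -> Prop) : set_system I :=
  filter_from [set: I] (fun i => [set j | le i j]).

Definition net_liminf (R : realType) (I : Type) (le : I -> I -> Prop)
    (f : I -> \bar R) : \bar R :=
  ereal_sup [set ereal_inf [set f j | j in [set j | le i j]] | i in [set: I]].

(* Functions defined on a subset only (on A here, on graphs below) are given
   by total functions, whose values off the subset are never used. *)
Definition lsc_at (R : realType) (T : topologicalType) (A : set T)
    (f : T -> \bar R) (a : T) : Prop :=
  forall (I : Type) (le : I -> I -> Prop) (s : I -> T), directed le ->
    (forall i, A (s i)) -> s @ tails le --> a ->
    f a <= net_liminf le (f \o s).

Definition graph_on (X Y : Type) (Z : set X) (F : X -> set Y) : set (X * Y) :=
  [set p | Z p.1 /\ F p.1 p.2].

Definition KN_inf_compact (R : realType) (X Y : topologicalType)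
    (Psi : X -> set Y) (w : X * Y -> \bar R) (Z : set X) : Prop :=
  (forall p, graph_on Z Psi p -> lsc_at (graph_on [set: X] Psi) w p) /\
  (forall (I : Type) (le : I -> I -> Prop) (xs : I -> X) (x : X),
    directed le -> Z x -> xs @ tails le --> x ->
    forall ys : I -> Y, (forall i, Psi (xs i) (ys i)) ->
      (exists M : R, forall i, w (xs i, ys i) <= M%:E) ->
      exists2 y, Psi x y & cluster (ys @ tails le) y).

Section parametric_minimization.
Variables (R : realType) (X Y : Type) (Phi : X -> set Y) (u : X * Y -> \bar R).

Definition value (z : X) : \bar R := ereal_inf [set u (z, y) | y in Phi z].

Definition solutions (z : X) : set Y :=
  [set y | Phi z y /\ value z = u (z, y)].

Definition level (lambda : R) (z : X) : set Y :=
  [set y | Phi z y /\ u (z, y) <= lambda%:E].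

(* The else branch is Phi_{lambda,x}(x), which is level lambda x by the first
   branch at z = x. *)
Definition level_map (lambda : R) (x z : X) : set Y :=
  if `[< level lambda z !=set0 \/ z = x >] then level lambda z
  else level lambda x.

Definition level_fun (lambda : R) (x : X) (p : X * Y) : \bar R :=
  if `[< level lambda p.1 !=set0 >] then u p else u (x, p.2).

End parametric_minimization.

(* Main.v *)
(** If f is lower semi-continuous at a, then f a <= c as soon as a is adherent to
    the sublevel set of c.  The accumulation points supplied by
    KN-inf-compactness make the level set at x compact, and minimizers are
    cluster points of the filter of sublevel sets.  For lower semi-continuity of
    the value: if value < c < value x held frequently along a net converging to
    x, near-minimizers along a subnet would accumulate at some y in Phi x with
    u (x, y) <= c. *)
Require Import Defs.
From HB Require Import structures.
From mathcomp Require Import all_boot all_order all_algebra.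
From mathcomp Require Import all_classical all_reals all_analysis.

Import Order.TTheory GRing.Theory Num.Theory.

Set Implicit Arguments.
Unset Strict Implicit.

Local Open Scope classical_set_scope.
Local Open Scope ereal_scope.

Lemma ereal_dense (R : realFieldType) (a b : \bar R) :
  a < b -> exists2 r : R, a < r%:E & r%:E < b.
Proof.
move: a b => [a| |] [b| |]//=; rewrite ?lte_fin => ab.
- by have [am mb] := midf_lt ab; exists ((a + b) / 2)%R; rewrite lte_fin.
- by exists (a + 1)%R; rewrite ?ltry// lte_fin ltrDl.
- by exists (b - 1)%R; rewrite ?ltNyr// lte_fin ltrBlDr ltrDl.
- by exists 0%R; rewrite ?ltry ?ltNyr.
Qed.

Lemma tails_filter (I : Type) (le : I -> I -> Prop) :
  directed le -> ProperFilter (tails le).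
Proof.
move=> [[i0] lexx letr leub]; apply: filter_from_proper; last first.
  by move=> i _; exists i; exact: lexx.
apply: filter_from_filter; first by exists i0.
move=> i j _ _; have [k [ik jk]] := leub i j; exists k => // l kl.
by split; [exact: letr ik kl | exact: letr jk kl].
Qed.

Lemma net_liminf_lt (R : realType) (I : Type) (le : I -> I -> Prop)
    (f : I -> \bar R) (c : \bar R) :
  net_liminf le f < c -> forall i, exists2 j, le i j & f j < c.
Proof.
move=> fc i; have /ereal_inf_lt[_ [j ij <-] fjc] :
    ereal_inf [set f j | j in [set j | le i j]] < c.
  by apply: le_lt_trans fc; apply: ereal_sup_ubound; exists i.
by exists j.
Qed.

(** Pairs of a neighbourhood and a point of the sublevel set in it, ordered by shrinking
    neighbourhoods, index a net that converges to [a] with all values at most [c]. *)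
Lemma lsc_at_closure (R : realType) (T : topologicalType) (A : set T)
    (f : T -> \bar R) (a : T) (c : \bar R) :
  lsc_at A f a -> closure [set p | A p /\ f p <= c] a -> f a <= c.
Proof.
move=> lscf clA.
(* Storing the point in the index makes the net a mere projection, with no choice function. *)
pose J := {q : set T * T | [/\ nbhs a q.1, q.1 q.2, A q.2 & f q.2 <= c]}.
pose le (j k : J) := (sval k).1 `<=` (sval j).1.
pose s (j : J) := (sval j).2.
have mk (U : set T) : nbhs a U -> exists j : J, (sval j).1 = U.
  move=> aU; have [p [[Ap fp] Up]] := clA U aU.
  by exists (exist _ (U, p) (And4 aU Up Ap fp)).
have dirJ : directed le.
  split.
  - by have [j _] := mk setT filterT; exists.
  - by move=> i; exact: subset_refl.
  - by move=> i j k ij jk; exact: subset_trans jk ij.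
  - move=> i j; have [[ai _ _ _] [aj _ _ _]] := (svalP i, svalP j).
    have [k kE] := mk _ (filterI ai aj).
    by exists k; split; rewrite /le kE => p [].
have sA j : A (s j) by have [] := svalP j.
have sa : s @ tails le --> a.
  move=> U /mk[j jU]; exists j => // k; rewrite /le jU => kU.
  by apply: kU; have [] := svalP k.
apply: le_trans (lscf _ _ _ dirJ sA sa) _.
rewrite leNgt; apply/negP => clt.
have [_ [j _ <-]] := ereal_sup_gt clt.
apply/negP; rewrite -leNgt; apply: le_trans (_ : f (s j) <= c).
  by apply: ereal_inf_lbound; exists j => //=.
by have [] := svalP j.
Qed.

Section level_map_theory.
Variables (R : realType) (X Y : topologicalType).
Variables (Phi : X -> set Y) (u : X * Y -> \bar R) (lambda : R) (x : X).
Hypothesis level_x : level Phi u lambda x !=set0.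

Let Psi := level_map Phi u lambda x.
Let w := level_fun Phi u lambda x.

Lemma level_mapE z : level Phi u lambda z !=set0 ->
  Psi z = level Phi u lambda z.
Proof. by move=> z0; rewrite /Psi /level_map asboolT//; left. Qed.

Lemma level_funE z y : level Phi u lambda z !=set0 -> w (z, y) = u (z, y).
Proof. by move=> z0; rewrite /w /level_fun asboolT. Qed.

Hypothesis KN : KN_inf_compact Psi w [set x].

(** Over level points [Psi] and [w] agree with [level] and [u], so the lower semi-continuity of [w]
    passes to [u]. *)
Lemma level_adherent_le (y : Y) (c : \bar R) : level Phi u lambda x y ->
  closure [set p | level Phi u lambda p.1 p.2 /\ u p <= c] (x, y) ->
  u (x, y) <= c.
Proof.
move=> xy clxy; rewrite -level_funE//; have [lscw _] := KN.
apply: lsc_at_closure.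
  by apply: lscw; split => //=; rewrite level_mapE.
apply: closureS clxy => -[z t] /= [zt uc].
have z0 : level Phi u lambda z !=set0 by exists t.
by split; [split => //=; rewrite level_mapE | rewrite level_funE].
Qed.

Lemma level_closure_le (y : Y) (c : \bar R) : level Phi u lambda x y ->
  closure [set t | level Phi u lambda x t /\ u (x, t) <= c] y ->
  u (x, y) <= c.
Proof.
move=> xy cly; apply: level_adherent_le => // W [[U V] /= [xU yV] UVW].
have [t [tc Vt]] := cly V yV; exists (x, t); split => //.
by apply: UVW; split => //=; exact: nbhs_singleton xU.
Qed.

(** A filter containing the level set is turned into a net, which condition (2) treats along the
    constant net [x], with bound [lambda]. *)
Lemma level_compact : compact (level Phi u lambda x).
Proof.
move=> F PF FL.
pose J := {q : set Y * Y | [/\ F q.1, q.1 q.2 & level Phi u lambda x q.2]}.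
pose le (j k : J) := (sval k).1 `<=` (sval j).1.
pose ys (j : J) := (sval j).2.
have mk (S : set Y) : F S -> exists j : J, (sval j).1 = S.
  move=> FS; have [y [Sy Ly]] := filter_ex (filterI FS FL).
  by exists (exist _ (S, y) (And3 FS Sy Ly)).
have dirJ : directed le.
  split.
  - by have [j _] := mk setT filterT; exists.
  - by move=> i; exact: subset_refl.
  - by move=> i j k ij jk; exact: subset_trans jk ij.
  - move=> i j; have [[Fi _ _] [Fj _ _]] := (svalP i, svalP j).
    have [k kE] := mk _ (filterI Fi Fj).
    by exists k; split; rewrite /le kE => p [].
have PT := tails_filter dirJ.
have ysL j : level Phi u lambda x (ys j) by have [] := svalP j.
have [_ acc] := KN.
have [|||y xy cly] := acc J le (fun=> x) x dirJ erefl _ ys.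
- exact: cvg_cst.
- by move=> j; rewrite level_mapE.
- by exists lambda => j; rewrite level_funE//; have [] := ysL j.
exists y; split; first by rewrite -level_mapE.
(* Every member of [F] contains a tail of [ys], so accumulation points of [ys] are cluster points of
   [F]. *)
apply: cvg_cluster cly => S /mk[j jS]; exists j => // k; rewrite /le jS => kS.
by apply: kS; have [] := svalP k.
Qed.

Lemma value_le_lambda : value Phi u x <= lambda%:E.
Proof.
have [y [Py uy]] := level_x.
by apply: le_trans uy; apply: ereal_inf_lbound; exists y.
Qed.

(** This sublevel form, valid because the infimum is at most [lambda], is the one to which
    [level_closure_le] applies. *)
Lemma solutionsE : solutions Phi u x =
  [set y | level Phi u lambda x y /\ u (x, y) <= value Phi u x].
Proof.
apply/seteqP; split=> y /=.
  move=> [Py vE]; rewrite vE lexx; split => //; split => //.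
  by rewrite -vE value_le_lambda.
move=> [[Py _] uv]; split => //; apply/eqP; rewrite eq_le uv andbT.
by apply: ereal_inf_lbound; exists y.
Qed.

Lemma solutions_compact : compact (solutions Phi u x).
Proof.
rewrite solutionsE => F PF FS.
have [|y [xy Fy]] := level_compact PF; first by apply: filterS FS => y [].
exists y; split => //; split => //; apply: level_closure_le => // V yV.
exact: Fy.
Qed.

(** The sublevel sets [sub y0] are nested, hence a filter base; a cluster point is adherent to each
    of them and so lies below every value on the level set. *)
Lemma solutions_nonempty : solutions Phi u x !=set0.
Proof.
pose sub y0 :=
  [set y | level Phi u lambda x y /\ u (x, y) <= u (x, y0)].
pose F := filter_from (level Phi u lambda x) sub.
have FF : ProperFilter F.
  apply: filter_from_proper; last by move=> y xy; exists y; split.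
  apply: filter_from_filter => // y1 y2 xy1 xy2.
  have [le12|/ltW le21] := leP (u (x, y1)) (u (x, y2)).
    by exists y1 => // y [xy uy]; do !split => //; exact: le_trans le12.
  by exists y2 => // y [xy uy]; do !split => //; exact: le_trans le21.
have [|y [xy Fy]] := level_compact FF.
  by have [y0 xy0] := level_x; exists y0 => // y [].
have ymin y0 : level Phi u lambda x y0 -> u (x, y) <= u (x, y0).
  move=> xy0; apply: level_closure_le => // V yV.
  by apply: Fy => //; exists y0.
exists y; rewrite solutionsE; split => //.
apply: le_ereal_inf_tmp => _ [t Pt <-].
(* Points of [Phi x] off the level set have values above [lambda], which already bounds
   [u (x, y)]. *)
have [ut|/ltW ut] := leP (u (x, t)) lambda%:E; first exact: ymin.
by apply: le_trans ut; exact: xy.2.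
Qed.

Lemma value_lsc : lsc_at [set: X] (value Phi u) x.
Proof.
move=> I le s dirI _ sx; rewrite leNgt; apply/negP => /ereal_dense[c Lc cv].
(* Each index carries a near-minimizer; [mk] shows that such indices are cofinal in [I]. *)
pose J := {q : I * Y | Phi (s q.1) q.2 /\ u (s q.1, q.2) < c%:E}.
pose leJ (j k : J) := le (sval j).1 (sval k).1.
pose xs (j : J) := s (sval j).1.
pose ys (j : J) := (sval j).2.
have mk i : exists j : J, le i (sval j).1.
  have [k ik] := net_liminf_lt Lc i.
  move=> /ereal_inf_lt[_ [y Py <-] uc].
  by exists (exist _ (k, y) (conj Py uc)).
have [[i0] lexx letr leub] := dirI.
have dirJ : directed leJ.
  split.
  - by have [j _] := mk i0; exists.
  - by move=> j; exact: lexx.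
  - by move=> i j k; exact: letr.
  - move=> i j; have [k [ik jk]] := leub (sval i).1 (sval j).1.
    by have [l kl] := mk k; exists l; split; [exact: letr ik kl|exact: letr jk kl].
have xsx : xs @ tails leJ --> x.
  move=> U /sx[i _ iU]; have [j ij] := mk i.
  by exists j => // k jk; apply: iU; exact: letr ij jk.
(* This puts all the near-minimizers in the level sets, where [level_fun] is [u] and is bounded by
   [lambda]. *)
have cl : c%:E <= lambda%:E by apply: le_trans (ltW cv) value_le_lambda.
have ysL j : level Phi u lambda (xs j) (ys j).
  by have [Py uc] := svalP j; split => //; exact: le_trans (ltW uc) cl.
have L0 j : level Phi u lambda (xs j) !=set0 by exists (ys j).
have [_ acc] := KN.
have [||y xy cly] := acc J leJ xs x dirJ erefl xsx ys.
- by move=> j; rewrite level_mapE.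
- by exists lambda => j; rewrite level_funE//; have [] := ysL j.
rewrite level_mapE// in xy.
suff uc : u (x, y) <= c%:E.
  move: cv; apply/negP; rewrite -leNgt; apply: le_trans uc.
  by apply: ereal_inf_lbound; exists y => //; exact: xy.1.
apply: level_adherent_le => // W [[U V] /= [xU yV] UVW].
have [j _ jU] := xsx U xU.
(* Clustering is tested on the tail beyond [j], so that one index [k] serves both coordinates. *)
have [_ [[k jk <-] Vk]] := cly (ys @` [set k | leJ j k]) V
  (ex_intro2 _ _ j Logic.I (fun k jk => imageP ys jk)) yV.
exists (xs k, ys k); split; last by apply: UVW; split => //; exact: jU.
by split; [exact: ysL | apply: ltW; have [] := svalP k].
Qed.

End level_map_theory.

Theorem corollary1 (R : realType) (X Y : topologicalType)
    (hX : hausdorff_space X) (hY : hausdorff_space Y)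
    (Phi : X -> set Y) (Phi_neq0 : forall z, Phi z !=set0)
    (u : X * Y -> \bar R) (x : X) (lambda : R)
    (hlambda : exists2 y, Phi x y & u (x, y) <= lambda%:E) :
  KN_inf_compact (level_map Phi u lambda x) (level_fun Phi u lambda x)
    [set x] ->
  lsc_at [set: X] (value Phi u) x /\
  solutions Phi u x !=set0 /\
  compact (solutions Phi u x).
Proof.
move=> KN.
have level_x : level Phi u lambda x !=set0.
  by have [y Py uy] := hlambda; exists y.
split; first exact: value_lsc level_x KN.
by split; [exact: solutions_nonempty KN | exact: solutions_compact KN].
Qed.
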